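(* Let $\alpha\in\mathbb{C}$ with $|\alpha|\le 1$ and $\alpha\notin\{-1,1\}$. Then there exists $C_1(\alpha)>0$ such that for all sufficiently large $n$ (depending on $\alpha$) and all $1\le j\le n$, $$\left|\lambda_{\alpha,n,j}-\lambda^{\mathrm{asympt}}_{\alpha,n,j}\right|\le\frac{C_1(\alpha)}{n^3},$$ where $$\lambda^{\mathrm{asympt}}_{\alpha,n,j}=g\left(\tfrac{j\pi}{n}\right)+\frac{g'\left(\tfrac{j\pi}{n}\right)\eta_{\alpha,j}\left(\tfrac{j\pi}{n}\right)}{n}+\frac{g'\left(\tfrac{j\pi}{n}\right)\eta_{\alpha,j}\left(\tfrac{j\pi}{n}\right)\eta_{\alpha,j}'\left(\tfrac{j\pi}{n}\right)+\frac12 g''\left(\tfrac{j\pi}{n}\right)\eta_{\alpha,j}\left(\tfrac{j\pi}{n}\right)^2}{n^2}.$$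
   Context: For $\alpha\in\mathbb{C}$ and an integer $n\ge 3$, $A_{\alpha,n}$ is the $n\times n$ complex matrix with all main diagonal entries equal to $2$, all entries on the first subdiagonal and on the first superdiagonal equal to $-1$, the $(1,n)$ entry equal to $-\overline{\alpha}$, the $(n,1)$ entry equal to $-\alpha$, and all other entries $0$. It is Hermitian, and its (real) eigenvalues, counted with multiplicity, are enumerated in ascending order: $\lambda_{\alpha,n,1}\le\cdots\le\lambda_{\alpha,n,n}$. The function $g$ is $g(x)=4\sin^2(x/2)$. For $\alpha\in\mathbb{C}\setminus\{-1,1\}$ put $k_\alpha=\frac{1-|\alpha|^2}{|1+\alpha|^2}$, $l_\alpha=\frac{|1-\alpha|}{|1+\alpha|}$, and for every integer $j$ define $\eta_{\alpha,j}\colon[0,\pi]\to\mathbb{R}$ by $$\eta_{\alpha,j}(x)=-2\arctan\left(\left((-1)^{j+1}k_\alpha\cot(x)+\sqrt{k_\alpha^2\cot^2(x)+l_\alpha^2}\right)^{(-1)^j}\right)$$ for $x\in(0,\pi)$, with the values at $x=0$ and $x=\pi$ understood as one-sided limits; the derivative $\eta_{\alpha,j}'$ at an endpoint of $[0,\pi]$ is the one-sided derivative. *)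

(* Defs.v *)
From HB Require Import structures.
From mathcomp Require Import all_boot all_order all_algebra.
From mathcomp Require Import complex.
From mathcomp Require Import all_classical all_reals all_analysis.
Set Implicit Arguments.
Unset Strict Implicit.
Unset Printing Implicit Defensive.
Import Order.TTheory GRing.Theory Num.Theory.
Import numFieldNormedType.Exports.
Local Open Scope classical_set_scope.
Local Open Scope complex_scope.
Local Open Scope ring_scope.

Definition cabs (R : realType) (z : R[i]) : R := ComplexField.Normc.normc z.

(* Rows and columns are numbered from 0 to n - 1 here. *)
Definition A (R : realType) (alpha : R[i]) (n : nat) : 'M[R[i]]_n :=
  \matrix_(i < n, j < n)
    if i == j :> nat then 2
    else if (i == j.+1 :> nat) || (j == i.+1 :> nat) then -1
    else if (i == 0%N :> nat) && (j == n.-1 :> nat) then - conjc alpha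
    else if (i == n.-1 :> nat) && (j == 0%N :> nat) then - alpha
    else 0.

(* The roots of the characteristic polynomial, with multiplicity. *)
Definition spectrum (R : realType) (n : nat) (M : 'M[R[i]]_n) : seq R[i] :=
  sval (closed_field_poly_normal (char_poly M)).

(* lambda alpha n j is the j-th smallest eigenvalue for 1 <= j <= n. Taking
   real parts only serves to obtain elements of R: the eigenvalues are real, see
   lambdaP. *)
Definition lambda (R : realType) (alpha : R[i]) (n j : nat) : R :=
  nth 0 (sort <=%R [seq complex.Re z | z <- spectrum (A alpha n)]) j.-1.

Definition g (R : realType) (x : R) : R := 4 * sin (x / 2) ^+ 2.

Definition cot (R : realType) (x : R) : R := cos x / sin x.

Definition kcoef (R : realType) (alpha : R[i]) : R :=
  (1 - cabs alpha ^+ 2) / cabs (1 + alpha) ^+ 2.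

Definition lcoef (R : realType) (alpha : R[i]) : R :=
  cabs (1 - alpha) / cabs (1 + alpha).

Definition eta_open (R : realType) (alpha : R[i]) (j : int) (x : R) : R :=
  let k := kcoef alpha in
  let l := lcoef alpha in
  - 2 * atan (((-1) ^ (j + 1) * k * cot x
               + Num.sqrt (k ^+ 2 * cot x ^+ 2 + l ^+ 2)) ^ ((-1) ^ j : int)).

(* Meaningful on [0, pi] only. *)
Definition eta (R : realType) (alpha : R[i]) (j : int) (x : R) : R :=
  if x == 0 then lim (eta_open alpha j y @[y --> 0^'+])
  else if x == pi then lim (eta_open alpha j y @[y --> pi^'-])
  else eta_open alpha j x.

Definition eta' (R : realType) (alpha : R[i]) (j : int) (x : R) : R :=
  if x == 0 then
    lim (((eta alpha j (0 + h) - eta alpha j 0) / h) @[h --> 0^'+])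
  else if x == pi then
    lim (((eta alpha j (pi + h) - eta alpha j pi) / h) @[h --> 0^'-])
  else derive1 (eta alpha j) x.

Definition lambda_asympt (R : realType) (alpha : R[i]) (n j : nat) : R :=
  let x : R := j%:R * pi / n%:R in
  let e := eta alpha j x in
  let e' := eta' alpha j x in
  g x
  + derive1 (@g R) x * e / n%:R
  + (derive1 (@g R) x * e * e' + 1 / 2 * derive1n 2 (@g R) x * e ^+ 2) / n%:R ^+ 2.

Lemma A_hermitian (R : realType) (alpha : R[i]) (n : nat) (hn : (3 <= n)%N) :
  (A alpha n)^T = map_mx conjc (A alpha n).
Proof.
apply/matrixP => i j; rewrite !mxE.
rewrite (eq_sym (j : nat) i) orbC.
case: ifP => _; first by rewrite (conjc_nat _ 2).
case: ifP => _; first by rewrite rmorphN1.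
case: ifP => [/andP[/eqP-> /eqP->]|H1].
  have -> : (n.-1 == 0)%N = false by case: n hn {i j} => [|[]].
  by rewrite /= eqxx rmorphN.
rewrite [(j == n.-1 :> nat) && _]andbC [(i == n.-1 :> nat) && _]andbC H1.
by case: ifP => _; [rewrite rmorphN /= conjcK | rewrite rmorph0].
Qed.

Lemma spectrumE (R : realType) (n : nat) (M : 'M[R[i]]_n) :
  char_poly M = \prod_(z <- spectrum M) ('X - z%:P).
Proof.
rewrite /spectrum; case: closed_field_poly_normal => r /= {1}->.
by rewrite (monicP (char_poly_monic M)) scale1r.
Qed.

Lemma size_spectrum (R : realType) (n : nat) (M : 'M[R[i]]_n) :
  size (spectrum M) = n.
Proof.
have := size_char_poly M.
by rewrite spectrumE size_prod_XsubC => -[].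
Qed.

Lemma spectrum_real (R : realType) (n : nat) (M : 'M[R[i]]_n) (z : R[i]) :
  M^T = map_mx conjc M -> z \in spectrum M -> z = (complex.Re z)%:C.
Proof.
move=> hM; rewrite -root_prod_XsubC -spectrumE -eigenvalue_root_char.
move=> /eigenvalueP[v vM v0].
have dotE (u w : 'rV[R[i]]_n) : (u *m w^T) 0 0 = \sum_i u 0 i * w 0 i.
  by rewrite mxE; apply: eq_bigr => i _; rewrite mxE.
pose w := map_mx conjc v.
have d0 : (v *m w^T) 0 0 != 0.
  rewrite dotE; apply: contra v0 => /eqP s0.
  have s0' : \sum_i `|v 0 i| ^+ 2 = 0.
    by rewrite -[RHS]s0; apply: eq_bigr => i _; rewrite sqr_normc !mxE.
  apply/eqP/rowP => i; rewrite mxE; apply/eqP.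
  have /psumr_eq0P : forall i : 'I_n, true -> 0 <= `|v 0 i| ^+ 2.
    by move=> k _; exact: exprn_ge0.
  by move=> /(_ s0') /(_ i isT) /eqP; rewrite expf_eq0 normr_eq0.
have E1 : (v *m M *m w^T) 0 0 = z * (v *m w^T) 0 0.
  by rewrite vM -scalemxAl mxE.
have E2 : (v *m M *m w^T) 0 0 = conjc z * (v *m w^T) 0 0.
  rewrite -mulmxA -[M]trmxK -trmx_mul hM -map_mxM vM.
  by rewrite !dotE mulr_sumr; apply: eq_bigr => i _; rewrite !mxE rmorphM mulrCA.
have : z = conjc z by apply: (mulIf d0); rewrite -E1 -E2.
case: z {vM E1 E2} => a b [] hb; rewrite /real_complex_def /=.
congr (_ +i* _); apply/eqP; move/eqP: hb.
by rewrite -subr_eq0 opprK -mulr2n mulrn_eq0.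
Qed.

Lemma lambdaP (R : realType) (alpha : R[i]) (n : nat) (hn : (3 <= n)%N) :
  char_poly (A alpha n) =
    \prod_(1 <= j < n.+1) ('X - ((lambda alpha n j)%:C)%:P) /\
  (forall i j, (1 <= i <= j)%N -> (j <= n)%N ->
     lambda alpha n i <= lambda alpha n j).
Proof.
set s := sort <=%R [seq complex.Re z | z <- spectrum (A alpha n)].
have ss : size s = n by rewrite size_sort size_map size_spectrum.
split; last first.
  move=> [//|i] [//|j] /= ij jn; apply: sorted_leq_nth => //.
  - exact: le_trans.
  - exact/sort_sorted/le_total.
  - by rewrite inE -/s ss (leq_trans _ jn).
  - by rewrite inE -/s ss.
rewrite spectrumE big_add1 /=.
transitivity (\prod_(x <- s) ('X - (x%:C)%:P)); last by rewrite (big_nth 0) ss.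
rewrite (perm_big _ (permEl (perm_sort _ _))) /= big_map.
rewrite !big_seq; apply: eq_bigr => z zs.
by rewrite -(spectrum_real (A_hermitian _ hn) zs).
Qed.

(* Main.v *)
Require Import Defs.
From mathcomp Require Import all_boot all_order all_algebra complex.
From mathcomp Require Import all_classical all_reals all_analysis.
From mathcomp Require Import ring lra zify.
Set Implicit Arguments.
Unset Strict Implicit.
Unset Printing Implicit Defensive.
Import Order.TTheory GRing.Theory Num.Theory.
Import numFieldNormedType.Exports.
Local Open Scope classical_set_scope.
Local Open Scope ring_scope.

(** Write lambda = g(x) = 2 - 2 cos x, m = |alpha|^2 and r = Re alpha. The sequence
    sin((n - i) x) + conj(alpha) sin(i x), i = 0, ..., n - 1, solves the three-term
    recurrence of the matrix; it meets the two corner conditions, hence is an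
    eigenvector, exactly when
      sin((n + 1) x) - m sin((n - 1) x) = 2 r sin x
    ([root_char_poly_A]). In terms of tan(n x / 2) this is a quadratic equation,
    whose two roots are of opposite signs; solving it for n x turns it into the
    family of equations n x = j pi + eta_j(x), with eta_j taking values in the open
    interval from -pi to 0 ([eta_open_char_eq]).

    The sign (-1)^j in eta_j amounts to replacing alpha by (-1)^j alpha
    ([eta_openE]): it is enough to study one function,
      phase k l x = -2 atan (- k cot x + sqrt (k^2 cot^2 x + l^2)),  k >= 0, l > 0.
    By the intermediate value theorem each equation has a solution x_j, and the range
    of eta_j forces it to lie strictly between (j - 1) pi / n and j pi / n
    ([exists_phase_solution]). So the g(x_j) are n distinct eigenvalues in increasing
    order, that is, all of them: lambda_j = g(x_j) holds for every n >= 3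
    ([lambda_eq_g]), without uniqueness of x_j being an issue.

    The expansion needs bounds up to the endpoints of [0, pi], where cot is singular.
    They come from an autonomous equation phase' = f(phase), in which f is a rational
    function of the cosine without poles, hence bounded and Lipschitz on the whole
    line ([phase_is_derive], [phase_slope_bounded_lipschitz]). This yields uniformly
    a first order Taylor formula for phase with quadratic remainder
    ([phase_increment]). With d = j pi / n, one has x_j = d + phase(x_j) / n, hence
      phase(x_j) = phase(d) + phase(d) phase'(d) / n + O(1/n^2),
    and the second order Taylor formula of g at d gives the theorem
    ([eigenvalue_expansion_bound]). For j = n, where d = pi, the value of eta is a
    limit; since g'(pi) = 0 the derivative of eta at pi is multiplied by zero, and
    only the Lipschitz bound is used there ([phase_at_left_pi]). *)

(** * Second order Taylor expansion of g, with an explicit cubic remainder *)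

Lemma mean_value (R : realType) (f df : R -> R) (a b : R) :
  a <= b -> (forall x, a <= x <= b -> is_derive x 1 f (df x)) ->
  exists2 c, a <= c <= b & f b - f a = df c * (b - a).
Proof.
move=> ab fdf.
have [||c cab ->] := @MVT_segment R f df a b ab.
- move=> x; rewrite in_itv/= => /andP[ax xb].
  by apply: fdf; rewrite (ltW ax) (ltW xb).
- apply: derivable_within_continuous => x; rewrite in_itv/= => xab.
  by have [] := fdf x xab.
- by exists c => //; move: cab; rewrite in_itv.
Qed.

(** The Taylor remainders of sine and cosine at 0 are obtained by iterating this step:
    by the mean value theorem each integration gains one power of |x|. *)
Lemma power_bound_integrate (R : realType) (f df : R -> R) (m : nat) :
  f 0 = 0 -> (forall x : R, is_derive x 1 f (df x)) ->
  (forall x, `|df x| <= `|x| ^+ m) -> forall x, `|f x| <= `|x| ^+ m.+1.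
Proof.
move=> f0 fdf dfm x.
have step c : `|c| <= `|x| -> `|df c * x| <= `|x| ^+ m.+1.
  move=> cx; rewrite normrM exprSr ler_wpM2r// (le_trans (dfm c))//.
  by rewrite lerXn2r ?nnegrE.
have [x0|x0] := leP 0 x.
- have [c /andP[c0 cx]] := @mean_value R f df 0 x x0 (fun y _ => fdf y).
  by rewrite f0 !subr0 => ->; apply: step; rewrite !ger0_norm.
- have [c /andP[xc c0]] := @mean_value R f df x 0 (ltW x0) (fun y _ => fdf y).
  rewrite f0 !sub0r => /(congr1 (fun y => `|y|)); rewrite normrN => ->.
  by rewrite mulrN normrN; apply: step; rewrite ler0_norm// ler0_norm ?lerN2// ltW.
Qed.

Lemma sin_abs_le (R : realType) (x : R) : `|sin x| <= `|x|.
Proof.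
rewrite -[leRHS]expr1; apply: (@power_bound_integrate R _ cos); first exact: sin0.
by move=> y; rewrite expr0 cos_max.
Qed.

Lemma one_minus_cos_le (R : realType) (m : nat) (x : R) : (m <= 1)%N ->
  `|1 - cos x| <= `|x| ^+ m.+1.
Proof.
move=> m1; apply: (@power_bound_integrate R (fun y => 1 - cos y) sin).
- by rewrite cos0 subrr.
- by move=> y; apply: is_derive_eq; rewrite opprK add0r mul1r.
- by case: m m1 => [|[|//]] _ y; rewrite ?expr0 ?sin_max// expr1 sin_abs_le.
Qed.

Lemma sin_minus_id_le (R : realType) (m : nat) (x : R) : (m <= 1)%N ->
  `|sin x - x| <= `|x| ^+ m.+2.
Proof.
move=> m1.
apply: (@power_bound_integrate R (fun y : R => sin y - y) (fun y => cos y - 1)).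
- by rewrite sin0 subrr.
- by move=> y; rewrite distrC one_minus_cos_le.
Qed.

Lemma cos_taylor2_le (R : realType) (x : R) :
  `|cos x - 1 + x ^+ 2 / 2| <= `|x| ^+ 3.
Proof.
apply: (@power_bound_integrate R (fun y : R => cos y - 1 + y ^+ 2 / 2)
                                 (fun y => - sin y + y)).
- by rewrite cos0 subrr expr0n mul0r addr0.
- move=> y /=; have d1 : is_derive y 1 (fun z : R => cos z - 1) (- sin y).
    by apply: is_derive_eq; rewrite subr0.
  have d2 : is_derive y 1 (fun z : R => z ^+ 2 / 2) y.
    by apply: is_derive_eq; rewrite /GRing.scale/=; field.
  exact: is_deriveD.
- by move=> y; rewrite addrC distrC (@sin_minus_id_le _ 0).
Qed.

Lemma gE (R : realType) (x : R) : g x = 2 - 2 * cos x.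
Proof.
rewrite /g sin2cos2; have -> : cos x = cos ((x / 2) *+ 2).
  by congr cos; rewrite -mulr_natr mulfVK// pnatr_eq0.
by rewrite cos_mulr2n -mulr_natr; ring.
Qed.

Lemma g_derive1 (R : realType) : derive1 (@g R) = (fun x => 2 * sin x).
Proof.
have -> : @g R = (fun x => 2 - 2 * cos x) by apply/funext => x; exact: gE.
apply/funext => x; have dg : is_derive x 1 (fun x : R => 2 - 2 * cos x) (2 * sin x).
  by apply: is_derive_eq; rewrite /GRing.scale/=; ring.
by rewrite derive1E derive_val.
Qed.

Lemma g_derive2 (R : realType) : derive1n 2 (@g R) = (fun x => 2 * cos x).
Proof.
rewrite derive1Sn derive1n1 g_derive1.
apply/funext => x; have dg : is_derive x 1 (fun x : R => 2 * sin x) (2 * cos x).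
  by apply: is_derive_eq; rewrite /GRing.scale/=; ring.
by rewrite derive1E derive_val.
Qed.

Lemma g_taylor2 (R : realType) (d h : R) :
  `|g (d + h) - (g d + 2 * sin d * h + cos d * h ^+ 2)| <= 4 * `|h| ^+ 3.
Proof.
rewrite !gE cosD.
have -> : 2 - 2 * (cos d * cos h - sin d * sin h) -
    (2 - 2 * cos d + 2 * sin d * h + cos d * h ^+ 2) =
    2 * (sin d * (sin h - h)) - 2 * (cos d * (cos h - 1 + h ^+ 2 / 2)) by field.
apply: le_trans (ler_normB _ _) _; rewrite !normrM normr_nat.
have := @sin_minus_id_le _ 1 h isT; have := cos_taylor2_le h.
have := cos_max d; have := sin_max d.
have := normr_ge0 (cos d); have := normr_ge0 (sin d).
have := normr_ge0 (sin h - h); have := normr_ge0 (cos h - 1 + h ^+ 2 / 2).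
move: `|sin d| `|cos d| `|sin h - h| `|_ + _| (`|h| ^+ 3) => a b c e q.
by nra.
Qed.

(** * The phase as the solution of an autonomous differential equation *)

(** Boundedness is kept together with the Lipschitz condition because Lipschitz
    functions alone are not closed under products. *)
Definition bounded_lipschitz (R : realType) (f : R -> R) : Prop :=
  exists M, forall x y, `|f x| <= M /\ `|f x - f y| <= M * `|x - y|.

Lemma bounded_lipschitz_cst (R : realType) (c : R) :
  bounded_lipschitz (fun _ => c).
Proof.
by exists `|c| => x y; split=> //; rewrite subrr normr0 mulr_ge0.
Qed.

Lemma bounded_lipschitz_cos (R : realType) : bounded_lipschitz (@cos R).
Proof.
exists 1; suff H (x y : R) : x <= y -> `|cos x - cos y| <= `|x - y|.
  move=> x y; split; [exact: cos_max|rewrite mul1r].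
  by have [/H//|/ltW/H] := leP x y; rewrite distrC [leRHS]distrC.
move=> xy; have [c _ e] := mean_value xy (fun z _ => is_derive_cos z).
by rewrite distrC [leRHS]distrC e normrM ler_piMl// normrN sin_max.
Qed.

Lemma bounded_lipschitzD (R : realType) (f h : R -> R) :
  bounded_lipschitz f -> bounded_lipschitz h ->
  bounded_lipschitz (fun x => f x + h x).
Proof.
move=> [M fM] [N hN]; exists (M + N) => x y.
have [f1 f2] := fM x y; have [h1 h2] := hN x y.
split; first by rewrite (le_trans (ler_normD _ _))// lerD.
by rewrite opprD addrACA (le_trans (ler_normD _ _))// mulrDl lerD.
Qed.

Lemma bounded_lipschitzM (R : realType) (f h : R -> R) :
  bounded_lipschitz f -> bounded_lipschitz h ->
  bounded_lipschitz (fun x => f x * h x).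
Proof.
move=> [M fM] [N hN]; exists (M * N * 2) => x y.
have [f1 f2] := fM x y; have [h1 h2] := hN x y.
have [f3 _] := fM y y; have [h3 _] := hN y y.
have MN : `|f x| * `|h x| <= M * N by rewrite ler_pM.
have MN0 : 0 <= M * N by apply: le_trans MN; rewrite mulr_ge0.
split; first by rewrite normrM (le_trans MN)// ler_peMr// ler1n.
have -> : f x * h x - f y * h y = f x * (h x - h y) + (f x - f y) * h y by ring.
rewrite (le_trans (ler_normD _ _))// !normrM.
have : `|f x| * `|h x - h y| <= M * (N * `|x - y|) by rewrite ler_pM.
have : `|f x - f y| * `|h y| <= M * `|x - y| * N by rewrite ler_pM.
by lra.
Qed.

Lemma bounded_lipschitzV (R : realType) (f : R -> R) (m : R) :
  0 < m -> (forall x, m <= f x) -> bounded_lipschitz f ->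
  bounded_lipschitz (fun x => (f x)^-1).
Proof.
move=> m0 mf [M fM]; exists (m^-1 + m^-1 * m^-1 * M) => x y.
have f0 z : 0 < f z := lt_le_trans m0 (mf z).
have fV z : `|(f z)^-1| <= m^-1.
  by rewrite gtr0_norm ?invr_gt0// lef_pV2 ?posrE.
have [f1 f2] := fM x y.
have M0 : 0 <= M := le_trans (normr_ge0 _) f1.
have mV0 : 0 < m^-1 by rewrite invr_gt0.
split; first by rewrite (le_trans (fV x))// lerDl !mulr_ge0// ltW.
have -> : (f x)^-1 - (f y)^-1 = (f x)^-1 * (f y)^-1 * (f y - f x).
  by field; rewrite !gt_eqF.
rewrite normrM normrM distrC.
have h : `|(f x)^-1| * `|(f y)^-1| <= m^-1 * m^-1 by rewrite ler_pM.
apply: le_trans (ler_pM _ _ h f2) _; [exact: mulr_ge0|exact: normr_ge0|].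
by rewrite mulrDl mulrA lerDr mulr_ge0// ltW.
Qed.

Definition phase_tan (R : realType) (k l x : R) : R :=
  - k * cot x + Num.sqrt (k ^+ 2 * cot x ^+ 2 + l ^+ 2).

Definition phase (R : realType) (k l x : R) : R := - 2 * atan (phase_tan k l x).

(** The right-hand side of the differential equation of [phase]. Expressing it through
    cos (phase) rather than through x removes the singularities at 0 and pi. *)
Definition phase_slope (R : realType) (k l y : R) : R :=
  - ((4 * k ^+ 2 * (1 - cos y ^+ 2) + (1 - cos y - l ^+ 2 * (1 + cos y)) ^+ 2) /
     (2 * k * (1 - cos y + l ^+ 2 * (1 + cos y)))).

(** The denominator is, up to the constant 2 k, a point of the segment from 2 to
    2 l^2, so it is bounded away from 0. For k = 0 the division by 0 makes the slope
    vanish, which is right: the phase is then constant. *)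
Lemma phase_slope_bounded_lipschitz (R : realType) (k l : R) :
  0 < l -> bounded_lipschitz (phase_slope k l).
Proof.
move=> l0.
have cst c := @bounded_lipschitz_cst R c; have Hcos := @bounded_lipschitz_cos R.
pose s := -1 : R.
pose num (y : R) := 4 * k ^+ 2 * (1 + s * (cos y * cos y)) +
  (1 + s * cos y + s * l ^+ 2 * (1 + cos y)) *
  (1 + s * cos y + s * l ^+ 2 * (1 + cos y)).
pose den (y : R) := 1 + s * cos y + l ^+ 2 * (1 + cos y).
have -> : phase_slope k l = (fun y => s * (2 * k)^-1 * (num y * (den y)^-1)).
  apply/funext => y; rewrite /phase_slope invfM.
  have -> : 1 - cos y + l ^+ 2 * (1 + cos y) = den y by rewrite /den /s; ring.
  by rewrite /num /s; ring.
have B1 := bounded_lipschitzD (cst 1) (bounded_lipschitzM (cst s) Hcos).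
have B2 := bounded_lipschitzD (cst 1) Hcos.
have B3 := bounded_lipschitzD B1 (bounded_lipschitzM (cst (s * l ^+ 2)) B2).
have B4 : bounded_lipschitz num.
  apply: bounded_lipschitzD (bounded_lipschitzM B3 B3).
  apply: bounded_lipschitzM (cst (4 * k ^+ 2)) _.
  exact: bounded_lipschitzD (cst 1)
    (bounded_lipschitzM (cst s) (bounded_lipschitzM Hcos Hcos)).
have B5 : bounded_lipschitz den.
  exact: bounded_lipschitzD B1 (bounded_lipschitzM (cst (l ^+ 2)) B2).
apply: bounded_lipschitzM (cst (s * (2 * k)^-1)) (bounded_lipschitzM B4 _).
apply: (@bounded_lipschitzV R den (Num.min 2 (2 * l ^+ 2))) => //.
  by rewrite lt_min ltr0n/= mulr_gt0// exprn_gt0.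
move=> y; rewrite /den /s ge_min.
have := cos_le1 y; have := cos_geN1 y; move: (cos y) => c c1 c2.
by have [l1|l1] := leP 1 (l ^+ 2); apply/orP; [left|right]; nra.
Qed.

Lemma phase_tan_gt0 (R : realType) (k l x : R) : 0 < l -> 0 < phase_tan k l x.
Proof.
move=> l0; rewrite /phase_tan mulNr addrC subr_gt0.
apply: le_lt_trans (ler_norm _) _.
have l2 : 0 < l ^+ 2 by rewrite exprn_gt0.
rewrite -sqrtr_sqr exprMn ltr_sqrt ?ltrDl//.
by rewrite ltr_wpDl// -exprMn sqr_ge0.
Qed.

(** [phase_tan] is the positive root of a quadratic equation. Later computations use
    it to eliminate l^2 and so avoid square roots. *)
Lemma phase_tan_quadratic (R : realType) (k l x : R) :
  phase_tan k l x ^+ 2 + 2 * k * cot x * phase_tan k l x = l ^+ 2.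
Proof.
rewrite /phase_tan; have : 0 <= k ^+ 2 * cot x ^+ 2 + l ^+ 2.
  by rewrite -exprMn addr_ge0 ?sqr_ge0.
move=> /sqr_sqrtr; move: (Num.sqrt _) => s s2.
by have -> : l ^+ 2 = s ^+ 2 - k ^+ 2 * cot x ^+ 2; [rewrite s2|]; ring.
Qed.

Lemma phase_tan_le (R : realType) (k l x : R) : 0 <= k -> 0 < l -> 0 <= cot x ->
  phase_tan k l x <= l.
Proof.
move=> k0 l0 c0; have u0 := phase_tan_gt0 k x l0.
have := phase_tan_quadratic k l x; have := mulr_ge0 (mulr_ge0 k0 c0) (ltW u0).
by nra.
Qed.

Lemma phase_tan_ge (R : realType) (k l x : R) : 0 <= k -> 0 < l -> cot x <= 0 ->
  l <= phase_tan k l x.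
Proof.
move=> k0 l0 c0; have u0 := phase_tan_gt0 k x l0.
have := phase_tan_quadratic k l x.
have := mulr_le0_ge0 (mulr_ge0_le0 k0 c0) (ltW u0).
by nra.
Qed.

Lemma phase_lt0 (R : realType) (k l x : R) : 0 < l -> phase k l x < 0.
Proof.
move=> l0; rewrite /phase mulNr oppr_lt0 mulr_gt0//.
by rewrite -(@atan0 R) lt_atan// phase_tan_gt0.
Qed.

Lemma phase_gtNpi (R : realType) (k l x : R) : - pi < phase k l x.
Proof. by rewrite /phase; have := atan_ltpi2 (phase_tan k l x); lra. Qed.

Lemma cos_2atan (R : realType) (u : R) :
  cos (- 2 * atan u) = (1 - u ^+ 2) / (1 + u ^+ 2).
Proof.
have p : 0 < 1 + u ^+ 2 by rewrite ltr_pwDl ?sqr_ge0.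
rewrite mulNr cosN mulrC mulr_natr cos_mulr2n cos_atan exprVn sqr_sqrtr ?ltW//.
by field; rewrite gt_eqF.
Qed.

Lemma sin_2atan (R : realType) (u : R) :
  sin (- 2 * atan u) = - (2 * u) / (1 + u ^+ 2).
Proof.
have p : 0 < 1 + u ^+ 2 by rewrite ltr_pwDl ?sqr_ge0.
have sq : 0 < Num.sqrt (1 + u ^+ 2) by rewrite sqrtr_gt0.
have -> : sin (- 2 * atan u) = - (2 * (cos (atan u) * sin (atan u))).
  by rewrite mulNr sinN mulrC mulr_natr sin_mulr2n -mulr_natl.
have -> : sin (atan u) = u * cos (atan u).
  rewrite -{2}(atanK u) /tan mulfVK//.
  by rewrite cos_atan invr_eq0 gt_eqF.
have -> : 2 * (cos (atan u) * (u * cos (atan u))) = 2 * u * cos (atan u) ^+ 2 by ring.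
by rewrite cos_atan exprVn sqr_sqrtr ?ltW// mulNr.
Qed.

Lemma cot_is_derive (R : realType) (x : R) : sin x != 0 ->
  is_derive x 1 (@cot R) (- (1 + cot x ^+ 2)).
Proof.
move=> s0; have dV := @is_deriveV R _ _ _ _ s0 (is_derive_sin x).
have := is_deriveM (is_derive_cos x) dV.
have -> : @cos R * (fun z => (sin z)^-1) = @cot R by apply/funext.
move=> H; apply: is_derive_eq; rewrite /GRing.scale/= /cot.
by field.
Qed.

(** With u = tan (- phase / 2), c = cot x and s = sqrt (k^2 c^2 + l^2), direct
    differentiation gives - 2 k u (1 + c^2) / (s (1 + u^2)). Substituting s = u + k c
    and l^2 = u^2 + 2 k c u in [phase_slope] gives the same fraction. *)
Lemma phase_is_derive (R : realType) (k l x : R) : 0 <= k -> 0 < l -> sin x != 0 ->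
  is_derive x 1 (phase k l) (phase_slope k l (phase k l x)).
Proof.
move=> k0 l0 s0; have dc := cot_is_derive s0.
set q := fun y : R => k ^+ 2 * cot y ^+ 2 + l ^+ 2.
have q0 : 0 < q x by rewrite /q -exprMn ltr_wpDl ?sqr_ge0// exprn_gt0.
have dq : is_derive x 1 q (k ^+ 2 * (2 * cot x * - (1 + cot x ^+ 2))).
  by apply: is_derive_eq; rewrite /GRing.scale/=; ring.
have ds := @is_derive1_comp _ (@Num.sqrt R) q x _ _ (is_derive1_sqrt q0) dq.
have c2 := sqr_sqrtr (ltW q0).
have r0 : 0 < Num.sqrt (q x) by rewrite sqrtr_gt0.
have du : is_derive x 1 (phase_tan k l)
    (k * phase_tan k l x * (1 + cot x ^+ 2) / Num.sqrt (q x)).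
  have := is_deriveD (is_deriveZ (- k) dc) ds.
  have -> : - k \*: @cot R + (@Num.sqrt R \o q) = phase_tan k l by apply/funext.
  move=> H; apply: is_derive_eq; rewrite /phase_tan -/(q x) /GRing.scale/=.
  by field; rewrite gt_eqF.
have u0 := phase_tan_gt0 k x l0; have uq := phase_tan_quadratic k l x.
have ru : Num.sqrt (q x) = phase_tan k l x + k * cot x.
  by rewrite /phase_tan -/(q x); ring.
have da := @is_derive1_comp _ (@atan R) (phase_tan k l) x _ _
   (is_derive1_atan (phase_tan k l x)) du.
have := is_deriveZ (- 2 : R) da.
have -> : - 2 \*: (@atan R \o phase_tan k l) = phase k l by apply/funext.
move=> H; apply: is_derive_eq; rewrite /phase_slope cos_2atan /GRing.scale/=.
rewrite -uq ru in r0 *; move: (phase_tan k l x) (cot x) u0 r0 => u c u0 r0.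
have p : 0 < 1 + u ^+ 2 by rewrite ltr_pwDl ?sqr_ge0.
have [->|k1] := eqVneq k 0; first by rewrite !(mulr0, mul0r, invr0, oppr0, addr0).
have den : 1 - (1 - u ^+ 2) / (1 + u ^+ 2) +
    (u ^+ 2 + 2 * k * c * u) * (1 + (1 - u ^+ 2) / (1 + u ^+ 2)) =
    4 * u * (u + k * c) / (1 + u ^+ 2) by field; rewrite gt_eqF.
have kp : 0 < k by rewrite lt_neqAle eq_sym k1.
by rewrite den; field; rewrite !gt_eqF.
Qed.

(** * The equation satisfied by the solutions of n x = j pi + phase x *)

(** The parameter that absorbs the alternating sign in the definition of eta. *)
Definition twist (R : realType) (j : nat) (alpha : R[i]) : R[i] := (-1) ^+ j * alpha.

Lemma cabs_sqr (R : realType) (z : R[i]) :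
  cabs z ^+ 2 = complex.Re z ^+ 2 + complex.Im z ^+ 2.
Proof. by case: z => a b; rewrite /cabs/= sqr_sqrtr// addr_ge0 ?sqr_ge0. Qed.

Lemma cabs_eq0 (R : realType) (z : R[i]) : (cabs z == 0) = (z == 0).
Proof.
apply/eqP/eqP => [/ComplexField.Normc.eq0_normc //|->].
by rewrite /cabs ComplexField.Normc.normc0.
Qed.

Lemma cabs_ge0 (R : realType) (z : R[i]) : 0 <= cabs z.
Proof. by case: z => a b; exact: sqrtr_ge0. Qed.

Lemma cabs_gt0 (R : realType) (z : R[i]) : z <> 0 -> 0 < cabs z.
Proof. by move=> /eqP z0; rewrite lt_neqAle cabs_ge0 eq_sym cabs_eq0 z0. Qed.

Lemma kcoef_ge0 (R : realType) (alpha : R[i]) : cabs alpha <= 1 -> 0 <= kcoef alpha.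
Proof.
move=> a1; rewrite /kcoef divr_ge0 ?exprn_ge0 ?cabs_ge0//.
by rewrite subr_ge0 -[leRHS](expr1n _ 2) lerXn2r ?nnegrE ?cabs_ge0.
Qed.

Lemma lcoef_gt0 (R : realType) (alpha : R[i]) :
  alpha <> 1 -> alpha <> -1 -> 0 < lcoef alpha.
Proof.
move=> a1 aN1; rewrite /lcoef divr_gt0// cabs_gt0//.
  by move/eqP; rewrite subr_eq0 => /eqP/esym.
by move/eqP; rewrite addrC addr_eq0 => /eqP.
Qed.

Lemma twist_odd (R : realType) (j : nat) (alpha : R[i]) :
  twist j alpha = if odd j then - alpha else alpha.
Proof. by rewrite /twist -signr_odd; case: odd; rewrite ?mulN1r ?mul1r. Qed.

(** Replacing alpha by - alpha turns k into k / l^2 and l into 1 / l, while inverting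
    k c + sqrt (k^2 c^2 + l^2) gives (- k c + sqrt (k^2 c^2 + l^2)) / l^2. *)
Lemma eta_openE (R : realType) (alpha : R[i]) (j : nat) (x : R) :
  alpha <> 1 -> alpha <> -1 ->
  eta_open alpha j x = phase (kcoef (twist j alpha)) (lcoef (twist j alpha)) x.
Proof.
move=> a1 aN1; rewrite /eta_open /phase; congr (_ * atan _).
have -> : (-1) ^ (j%:Z + 1) = (if odd j then 1 else -1) :> R.
  by rewrite -[j%:Z + 1]PoszD addn1 -exprnP exprS -signr_odd;
     case: odd; rewrite ?expr1 ?mulrNN mulr1.
have -> : (-1) ^ j%:Z = (if odd j then -1 else 1) :> int.
  by rewrite -exprnP -signr_odd; case: odd.
rewrite twist_odd; case: odd; last by rewrite mulN1r expr1z.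
rewrite mul1r exprN1.
have pa : 0 < cabs (1 + alpha).
  by apply: cabs_gt0 => /eqP; rewrite addrC addr_eq0 => /eqP.
have pb : 0 < cabs (1 - alpha).
  by apply: cabs_gt0 => /eqP; rewrite subr_eq0 => /eqP/esym.
rewrite /phase_tan /kcoef /lcoef opprK.
have -> : cabs (- alpha) = cabs alpha by rewrite /cabs normcN.
move: (cabs (1 + alpha)) (cabs (1 - alpha)) (1 - cabs alpha ^+ 2) (cot x) pa pb
  => a b K c a0 b0.
set q := (K / a ^+ 2) ^+ 2 * c ^+ 2 + (b / a) ^+ 2.
have -> : (K / b ^+ 2) ^+ 2 * c ^+ 2 + (a / b) ^+ 2 = q * (a ^+ 2 / b ^+ 2) ^+ 2.
  by rewrite /q; field; rewrite !gt_eqF.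
have q0 : 0 <= q by rewrite addr_ge0 -?exprMn ?sqr_ge0.
rewrite sqrtrM// sqrtr_sqr ger0_norm ?divr_ge0 ?sqr_ge0//.
have := sqr_sqrtr q0; move: (Num.sqrt q) => s; move=> sq; rewrite {q0}/q in sq.
have prod1 : (K / a ^+ 2 * c + s) * (- (K / b ^+ 2) * c + s * (a ^+ 2 / b ^+ 2)) = 1.
  transitivity ((s ^+ 2 - (K / a ^+ 2) ^+ 2 * c ^+ 2) * (a ^+ 2 / b ^+ 2)).
    by field; rewrite !gt_eqF.
  by rewrite sq; field; rewrite !gt_eqF.
by apply: (mulfI _ (etrans (divff _) (esym prod1)));
  apply: contraPneq prod1 => ->; rewrite mul0r => /esym/eqP; rewrite oner_eq0.
Qed.

(** Expand in sin (n x) and cos (n x): the shift by j pi produces the sign (-1)^j,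
    which also relates alpha to its twist, and the half-angle formulas for
    phase = -2 atan u reduce the claim to the quadratic equation of u. *)
Lemma eta_open_char_eq (R : realType) (alpha : R[i]) (n j : nat) (x : R) :
  alpha <> 1 -> alpha <> -1 -> sin x != 0 ->
  n%:R * x = j%:R * pi + phase (kcoef (twist j alpha)) (lcoef (twist j alpha)) x ->
  sin (n%:R * x + x) - cabs alpha ^+ 2 * sin (n%:R * x - x) =
    2 * complex.Re alpha * sin x.
Proof.
move=> a1 aN1 s0 nx; rewrite sinD sinB nx.
set b := twist j alpha in nx *; set k := kcoef b; set l := lcoef b.
have cb : cabs alpha = cabs b.
  by rewrite /b twist_odd; case: odd; rewrite // /cabs normcN.
have rb : complex.Re alpha = (-1) ^+ j * complex.Re b.
  rewrite /b twist_odd -signr_odd; case: odd; rewrite ?mul1r//.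
  by case: (alpha) => p q /=; rewrite mulN1r opprK.
have [b1 bN1] : b <> 1 /\ b <> -1.
  by rewrite /b twist_odd; case: odd; split=> //;
    [move/(congr1 -%R); rewrite opprK|move/oppr_inj].
rewrite [_ + phase _ _ _]addrC mulr_natl.
rewrite (alternatingn (@sinDpi R)) (alternatingn (@cosDpi R)).
rewrite cb rb /phase cos_2atan sin_2atan.
have u0 : 0 < phase_tan k l x by apply/phase_tan_gt0/lcoef_gt0.
have := phase_tan_quadratic k l x.
move: (phase_tan k l x) u0 => u u0; rewrite {}/k {}/l /kcoef /lcoef expr_div_n.
have pb : 0 < cabs (1 + b) ^+ 2.
  by rewrite exprn_gt0// cabs_gt0// => /eqP; rewrite addrC addr_eq0 => /eqP.
have m1 : cabs (1 + b) ^+ 2 = 1 + cabs b ^+ 2 + 2 * complex.Re b.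
  by rewrite !cabs_sqr; case: (b) => p q /=; ring.
have m2 : cabs (1 - b) ^+ 2 = 1 + cabs b ^+ 2 - 2 * complex.Re b.
  by rewrite !cabs_sqr; case: (b) => p q /=; ring.
rewrite m1 in pb *; rewrite m2 /cot.
move: (cabs b ^+ 2) (complex.Re b) (cos x) (sin x) s0 pb => m r X Y Y0 D0.
move: ((-1) ^+ j) => S quad.
have p : 0 < 1 + u ^+ 2 by rewrite ltr_pwDl ?sqr_ge0.
have {}quad : (1 + m + 2 * r) * Y * u ^+ 2 + 2 * (1 - m) * X * u = (1 + m - 2 * r) * Y.
  transitivity ((1 + m + 2 * r) * Y *
      (u ^+ 2 + 2 * ((1 - m) / (1 + m + 2 * r)) * (X / Y) * u)).
    by field; rewrite Y0 gt_eqF.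
  by rewrite quad; field; rewrite gt_eqF.
apply/eqP; rewrite -subr_eq0; apply/eqP.
transitivity (S / (1 + u ^+ 2) * ((1 + m - 2 * r) * Y -
    ((1 + m + 2 * r) * Y * u ^+ 2 + 2 * (1 - m) * X * u))).
  by field; rewrite gt_eqF.
by rewrite quad subrr mulr0.
Qed.


(** A row vector times the matrix, read as a three-term recurrence in which the two
    neighbours missing at the ends are supplied by the corner entries. *)
Lemma eigenvector_entry (R : realType) (alpha : R[i]) (n : nat) (w : nat -> R[i])
    (j : 'I_n) : (3 <= n)%N ->
  ((\row_(i < n) w i) *m A alpha n) 0 j =
  2 * w j - (if j.+1 == n then conjc alpha * w 0%N else w j.+1)
          - (if j == 0%N :> nat then alpha * w n.-1 else w j.-1).
Proof.
move=> n3.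
have pick (c : nat) : \sum_(i < n) (w i * (i == c :> nat)%:R) = (c < n)%:R * w c.
  case: ltnP => cn; last first.
    rewrite mul0r big1// => i _; case: eqP => [ic|]; last by rewrite mulr0.
    by have := ltn_ord i; rewrite ic ltnNge cn.
  rewrite (bigD1 (Ordinal cn))//= eqxx mulr1 mul1r big1 ?addr0// => i.
  by rewrite -val_eqE/= => /negbTE ->; rewrite mulr0.
rewrite mxE.
transitivity (\sum_(i < n) (w i * (i == j :> nat)%:R * 2 - w i * (i == j.+1 :> nat)%:R
  - (0 < j)%N%:R * (w i * (i == j.-1 :> nat)%:R)
  - (j == n.-1 :> nat)%:R * conjc alpha * (w i * (i == 0%N :> nat)%:R)
  - (j == 0%N :> nat)%:R * alpha * (w i * (i == n.-1 :> nat)%:R))).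
  apply: eq_bigr => i _; rewrite !mxE.
  have := ltn_ord j; have := ltn_ord i; move: (nat_of_ord i) (nat_of_ord j).
  move=> {j}i j ltin ltjn; move: (w i) => {pick w}x.
  case: (i =P j); case: (i =P j.+1); case: (j =P i.+1); case: (i =P 0%N);
    case: (j =P n.-1); case: (i =P n.-1); case: (j =P 0%N);
    case: (i =P j.-1); case: (ltnP 0 j); try (move=> *; exfalso; lia);
    move=> * /=; ring.
rewrite !sumrB -mulr_suml -!mulr_sumr !pick ltn_ord.
have nE : n = n.-1.+1 by lia.
have -> : (n.-1 < n)%N by lia.
have -> : (0 < n)%N by lia.
have -> : (j.-1 < n)%N by have := ltn_ord j; lia.
have -> : (j == n.-1 :> nat) = (j.+1 == n) by apply/eqP/eqP; lia.
have -> : (j.+1 < n)%N = (j.+1 != n) by have := ltn_ord j; lia.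
case: (j.+1 == n); case: (nat_of_ord j) => [|i] /=; ring.
Qed.

(** * Eigenvectors, and the enumeration of the whole spectrum *)

Lemma kcoef_twist_ge0 (R : realType) (alpha : R[i]) (j : nat) :
  cabs alpha <= 1 -> 0 <= kcoef (twist j alpha).
Proof.
by move=> a1; apply: kcoef_ge0; rewrite twist_odd; case: odd; rewrite // /cabs normcN.
Qed.

Lemma lcoef_twist_gt0 (R : realType) (alpha : R[i]) (j : nat) :
  alpha <> 1 -> alpha <> -1 -> 0 < lcoef (twist j alpha).
Proof.
move=> a1 aN1; apply: lcoef_gt0; rewrite twist_odd; case: odd => //.
  by move/(congr1 -%R); rewrite opprK.
by move/oppr_inj.
Qed.

(** The sequence w is defined for a real index so that one addition formula covers all
    entries. The condition at the right end, w n = conj(alpha) w 0, then holds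
    identically and the one at the left end, w (-1) = alpha w (n - 1), is the
    characteristic equation. The vector is not zero since w 0 = sin (n x). *)
Lemma root_char_poly_A (R : realType) (alpha : R[i]) (n : nat) (x : R) :
  (3 <= n)%N -> sin (n%:R * x) != 0 ->
  sin (n%:R * x + x) - cabs alpha ^+ 2 * sin (n%:R * x - x) =
    2 * complex.Re alpha * sin x ->
  root (char_poly (A alpha n)) (g x)%:C%C.
Proof.
move=> n3 sn0 char_eq; rewrite -eigenvalue_root_char; apply/eigenvalueP.
pose a (t : R) := sin (n%:R * x - t * x); pose b (t : R) := sin (t * x).
pose w (t : R) := (a t)%:C%C + conjc alpha * (b t)%:C%C : R[i].
exists (\row_(i < n) w i%:R); last first.
  have n0 : (0 < n)%N by lia.
  apply/eqP => /rowP/(_ (Ordinal n0)); rewrite !mxE /w /a /b /=.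
  rewrite !mul0r sin0 subr0 mulr0 addr0 => /complexI/eqP; exact/negP.
have rec (t : R) : w (t + 1) + w (t - 1) = (2 - (g x)%:C%C) * w t.
  have aE : a (t + 1) + a (t - 1) = (2 - g x) * a t.
    rewrite /a gE !mulrDl mulN1r mul1r.
    have -> : n%:R * x - (t * x + x) = n%:R * x - t * x - x by ring.
    have -> : n%:R * x - (t * x - x) = n%:R * x - t * x + x by ring.
    by rewrite !(sinD _ x) !(sinB _ x); ring.
  have bE : b (t + 1) + b (t - 1) = (2 - g x) * b t.
    by rewrite /b gE !mulrDl mulN1r mul1r !(sinD _ x) !(sinB _ x); ring.
  transitivity ((a (t + 1) + a (t - 1))%:C%C
                + conjc alpha * (b (t + 1) + b (t - 1))%:C%C).
    by rewrite /w !rmorphD; ring.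
  rewrite aE bE /w; move: (g x) (a t) (b t) => y p q.
  by rewrite !rmorphM rmorphB rmorph_nat /=; ring.
have right_end : conjc alpha * w 0 = w n%:R.
  by rewrite /w /a /b !mul0r subr0 subrr sin0 rmorph0 mulr0 addr0 add0r.
have left_end : alpha * w n.-1%:R = w (- 1).
  have -> : n.-1%:R = n%:R - 1 :> R by rewrite -subn1 natrB//; lia.
  rewrite /w /a /b mulrBl mul1r mulN1r opprK sinN opprB addrCA subrr addr0.
  have -> : alpha * ((sin x)%:C%C + conjc alpha * (sin (n%:R * x - x))%:C%C) =
      alpha * (sin x)%:C%C + (cabs alpha ^+ 2 * sin (n%:R * x - x))%:C%C.
    rewrite mulrDr mulrA rmorphM; congr (_ + _ * _).
    by rewrite -sqr_normc rmorphXn.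
  have -> : sin (n%:R * x + x) =
      2 * complex.Re alpha * sin x + cabs alpha ^+ 2 * sin (n%:R * x - x).
    by rewrite -char_eq subrK.
  rewrite rmorphD rmorphN addrAC; congr (_ + _).
  rewrite rmorphM mulrN -mulrBl; congr (_ * _).
  by case: (alpha) => p q; rewrite /real_complex_def/=; congr Complex => /=; ring.
apply/rowP => j; rewrite (@eigenvector_entry _ _ _ (fun i => w i%:R))// !mxE.
have -> : (if j.+1 == n then conjc alpha * w 0%:R else w j.+1%:R) = w (j%:R + 1).
  by case: eqP => [jn|_]; rewrite natr1// jn right_end.
have -> : (if j == 0%N :> nat then alpha * w n.-1%:R else w j.-1%:R) = w (j%:R - 1).
  case: (nat_of_ord j) => [|i] /=; first by rewrite left_end sub0r.
  by rewrite -natr1 addrK.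
by rewrite -addrA -opprD rec; ring.
Qed.

(** This bound and the next one keep the phase away from -pi near 0 and away from 0
    near pi. They locate the first and the last solution, for which the interval
    touches an endpoint where cot is singular. *)
Lemma phase_ge (R : realType) (k l x : R) : 0 <= k -> 0 < l -> 0 < x <= pi / 2 ->
  - 2 * atan l <= phase k l x.
Proof.
move=> k0 l0 /andP[x0 x1]; rewrite /phase ler_nM2l ?oppr_lt0//.
apply: le_atan; apply: phase_tan_le => //.
rewrite divr_ge0// ?cos_ge0_pihalf ?sin_ge0_pi//.
  by rewrite x1 andbT; have := pi_gt0 R; lra.
by have := pi_gt0 R; lra.
Qed.

Lemma phase_le (R : realType) (k l x : R) : 0 <= k -> 0 < l -> pi / 2 <= x < pi ->
  phase k l x <= - 2 * atan l.
Proof.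
move=> k0 l0 /andP[x0 x1]; rewrite /phase ler_nM2l ?oppr_lt0//.
apply: le_atan; apply: phase_tan_ge => //.
have p0 := pi_gt0 R; have -> : x = (x - pi) + pi by ring.
rewrite /cot cosDpi sinDpi invrN mulrNN; have -> : x - pi = - (pi - x) by ring.
rewrite cosN sinN invrN mulrN oppr_le0 divr_ge0//.
  by apply: cos_ge0_pihalf; lra.
by apply: sin_ge0_pi; lra.
Qed.

(** Intermediate value theorem for n x - phase x. The interval is open because the
    phase never reaches -pi or 0, so any solution found between the two test points
    lies strictly inside. *)
Lemma exists_phase_solution (R : realType) (k l : R) (n j : nat) :
  0 <= k -> 0 < l -> (1 < n)%N -> (1 <= j <= n)%N ->
  exists2 x, j.-1%:R * pi / n%:R < x < j%:R * pi / n%:R &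
    n%:R * x = j%:R * pi + phase k l x.
Proof.
move=> k0 l0 n1 /andP[j0 jn].
pose h x := n%:R * x - phase k l x.
have p0 := pi_gt0 R.
have n2 : 2 <= n%:R :> R by rewrite ler_nat.
have nR : 0 < n%:R :> R by apply: lt_le_trans n2.
have nK (y : R) : n%:R * (y / n%:R) = y by rewrite mulrC mulfVK// gt_eqF.
have al0 : 0 < atan l by rewrite -(@atan0 R) lt_atan.
have al1 := atan_ltpi2 l.
have jE : j%:R = j.-1%:R + 1 :> R by rewrite natr1 prednK.
(* The left test point is (j - 1) pi / n, except for j = 1: there a point near 0 is
   chosen with n a = pi / 2 - atan l, so that n a - phase a <= pi / 2 + atan l < pi. *)
have [a [a0 la ha]] : exists a : R, [/\ 0 < a,
    n%:R * a <= (j.-1%:R + 2^-1) * pi & h a <= j%:R * pi].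
  have [j1|j1] := leqP j 1.
    have -> : j = 1%N by lia.
    exists ((pi / 2 - atan l) / n%:R).
    have na : n%:R * ((pi / 2 - atan l) / n%:R) = pi / 2 - atan l.
      exact: nK.
    have pa : 0 < (pi / 2 - atan l) / n%:R by rewrite divr_gt0// subr_gt0.
    rewrite /h na /=; split=> //; first lra.
    have := @phase_ge R k l ((pi / 2 - atan l) / n%:R) k0 l0.
    rewrite pa /=; have -> : (pi / 2 - atan l) / n%:R <= pi / 2 by nra.
    by move=> /(_ isT); lra.
  exists (j.-1%:R * pi / n%:R).
  have na : n%:R * (j.-1%:R * pi / n%:R) = j.-1%:R * pi :> R.
    exact: nK.
  have jp : 1 <= j.-1%:R :> R by rewrite ler1n; lia.
  rewrite /h na; split; [|lra|].
    by rewrite divr_gt0// mulr_gt0//; lra.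
  by have := phase_gtNpi k l (j.-1%:R * pi / n%:R); rewrite jE; lra.
(* Similarly on the right: j pi / n is replaced by pi - atan l / n when j = n. *)
have [b [bp lb hb]] : exists b : R, [/\ b < pi,
    (j%:R - 2^-1) * pi <= n%:R * b & j%:R * pi <= h b].
  have [->|jn'] := eqVneq j n.
    exists (pi - atan l / n%:R).
    have na : n%:R * (pi - atan l / n%:R) = n%:R * pi - atan l.
      by rewrite mulrBr nK.
    have pb : 0 < atan l / n%:R by rewrite divr_gt0.
    rewrite /h na; split; [lra|lra|].
    have := @phase_le R k l (pi - atan l / n%:R) k0 l0.
    have -> : pi / 2 <= pi - atan l / n%:R < pi by apply/andP; split; nra.
    by move=> /(_ isT); lra.
  exists (j%:R * pi / n%:R).
  have na : n%:R * (j%:R * pi / n%:R) = j%:R * pi :> R by exact: nK.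
  have jln : j%:R < n%:R :> R by rewrite ltr_nat ltn_neqAle jn' jn.
  rewrite /h na; split; [|lra|].
    by rewrite ltr_pdivrMr// mulrC ltr_pM2l.
  by have := @phase_lt0 R k l (j%:R * pi / n%:R) l0; lra.
have ab : a <= b.
  rewrite -(ler_pM2l nR); apply: le_trans lb.
  by rewrite jE; lra.
have [||c] := @IVT R h a b (j%:R * pi) ab.
- apply: derivable_within_continuous => x; rewrite in_itv/= => /andP[ax xb].
  have sx : sin x != 0 by rewrite gt_eqF// sin_gt0_pi//; apply/andP; split; lra.
  have [d1 _] := phase_is_derive k0 l0 sx.
  apply: derivableB; last exact: d1.
  by apply: derivableZ; exact: derivable_id.
- by rewrite ge_min ha/= le_max hb orbT.
rewrite in_itv/= => /andP[ac cb] hc.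
have nc : n%:R * c = j%:R * pi + phase k l c by rewrite -hc /h subrK.
exists c => //; rewrite ltr_pdivrMr// ltr_pdivlMr// [c * _]mulrC nc.
by have := phase_lt0 k c l0; have := phase_gtNpi k l c; rewrite jE; lra.
Qed.


(** An increasing family of n roots of a polynomial of degree n is its list of roots
    in sorted order. *)
Lemma lambda_of_roots (R : realType) (alpha : R[i]) (n : nat) (mu : nat -> R) :
  (3 <= n)%N ->
  (forall j, (j < n)%N -> root (char_poly (A alpha n)) (mu j)%:C%C) ->
  (forall i j, (i < j < n)%N -> mu i < mu j) ->
  forall j, (j < n)%N -> lambda alpha n j.+1 = mu j.
Proof.
move=> n3 muroot mulo j jn.
pose L := [seq lambda alpha n i.+1 | i <- iota 0 n].
pose M := [seq mu i | i <- iota 0 n].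
suff LM : L = M.
  have := congr1 (fun s => nth 0 s j) LM.
  by rewrite !(nth_map 0%N) ?size_iota// !nth_iota.
have [chp lmono] := lambdaP alpha n3.
have Msorted : sorted <%R M.
  rewrite sorted_map; apply/(sortedP 0%N) => i; rewrite size_iota => lin.
  by rewrite !nth_iota ?add0n//=; [apply: mulo; lia|lia].
have Lsorted : sorted <=%R L.
  rewrite sorted_map; apply/(sortedP 0%N) => i; rewrite size_iota => lin.
  by rewrite !nth_iota ?add0n//=; [apply: lmono; lia|lia].
apply: le_sorted_eq => //; first by move: Msorted; rewrite lt_sorted_uniq_le => /andP[].
apply: (perm_map_inj (@complexI R)); apply: prod_XsubC_eq.
transitivity (char_poly (A alpha n)).
  by rewrite chp /L !big_map big_add1/= /index_iota subn0.
have sz : size (char_poly (A alpha n)) = (size [seq z%:C%C | z <- M]).+1.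
  by rewrite size_char_poly !size_map size_iota.
rewrite [LHS](all_roots_prod_XsubC sz).
- by rewrite (monicP (char_poly_monic _)) scale1r.
- apply/allP => _ /mapP[_ /mapP[i + ->] ->].
  by rewrite mem_iota => /andP[_ lin]; exact: muroot.
- rewrite uniq_rootsE map_inj_uniq ?lt_sorted_uniq//; exact: complexI.
Qed.

(** * The expansion *)

Lemma g_increasing (R : realType) (x y : R) :
  0 <= x -> x < y -> y <= pi -> g x < g y.
Proof.
move=> x0 xy ypi; rewrite !gE ltrD2l ltrN2 ltr_pM2l// ltr_cos// in_itv/=.
  by rewrite x0 (ltW (lt_le_trans xy ypi)).
by rewrite ypi (ltW (le_lt_trans x0 xy)).
Qed.

(** Exact, not asymptotic: the eigenvalues are g at the solutions of
    n x = j pi + eta_j x. *)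
Lemma lambda_eq_g (R : realType) (alpha : R[i]) (n j : nat) :
  cabs alpha <= 1 -> alpha <> 1 -> alpha <> -1 -> (3 <= n)%N -> (1 <= j <= n)%N ->
  exists x, [/\ j.-1%:R * pi / n%:R < x < j%:R * pi / n%:R,
    n%:R * x = j%:R * pi + phase (kcoef (twist j alpha)) (lcoef (twist j alpha)) x &
    lambda alpha n j = g x].
Proof.
move=> ale a1 aN1 n3 jn.
have k0 i : 0 <= kcoef (twist i alpha) by exact: kcoef_twist_ge0.
have l0 i : 0 < lcoef (twist i alpha) by exact: lcoef_twist_gt0.
have n0 : 0 < n%:R :> R by rewrite ltr0n; lia.
have sol i : exists x, (1 <= i <= n)%N ->
    i.-1%:R * pi / n%:R < x < i%:R * pi / n%:R /\
    n%:R * x = i%:R * pi + phase (kcoef (twist i alpha)) (lcoef (twist i alpha)) x.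
  have [iin|/negP ni] := boolP (1 <= i <= n)%N; last by exists 0.
  have n1 : (1 < n)%N by lia.
  by have [x x1 x2] := exists_phase_solution (k0 i) (l0 i) n1 iin;
    exists x.
have [theta thetaP] := choice sol.
have theta0 i : (1 <= i <= n)%N -> 0 < theta i < pi.
  move=> iin; have [/andP[t1 t2] _] := thetaP i iin; apply/andP; split.
    by apply: le_lt_trans t1; rewrite divr_ge0 ?mulr_ge0 ?pi_ge0// ltW.
  apply: lt_le_trans t2 _; rewrite ler_pdivrMr// mulrC ler_wpM2l ?pi_ge0//.
  by rewrite ler_nat; lia.
have [tj1 tj2] := thetaP j jn; exists (theta j); split=> //.
have := @lambda_of_roots R alpha n (fun i => g (theta i.+1)) n3.
have -> : j = j.-1.+1 by lia.
apply=> [i lin||]; last lia.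
- have iin : (1 <= i.+1 <= n)%N by lia.
  have [_ ti] := thetaP _ iin.
  set k := kcoef _ in ti; set l := lcoef _ in ti.
  have sx : sin (theta i.+1) != 0 by rewrite gt_eqF// sin_gt0_pi// theta0.
  apply: root_char_poly_A => //; last exact: eta_open_char_eq ti.
  rewrite ti addrC mulr_natl (alternatingn (@sinDpi R)) mulf_neq0 ?signr_eq0//.
  have -> : phase k l (theta i.+1) = - (- phase k l (theta i.+1)) by rewrite opprK.
  rewrite sinN oppr_eq0 gt_eqF// sin_gt0_pi//.
  have := phase_lt0 k (theta i.+1) (l0 i.+1).
  by have := phase_gtNpi k l (theta i.+1); lra.
- move=> i m /andP[im mn].
  have [/andP[_ ti] _] := thetaP i.+1 ltac:(lia).
  have [/andP[tm _] _] := thetaP m.+1 ltac:(lia).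
  have /andP[pi0 _] := theta0 i.+1 ltac:(lia).
  have /andP[_ pm] := theta0 m.+1 ltac:(lia).
  apply: g_increasing; [exact: ltW| |exact: ltW].
  apply: lt_trans ti _; apply: le_lt_trans tm.
  rewrite ler_pM2r ?invr_gt0// ler_pM2r ?pi_gt0// ler_nat; lia.
Qed.

Lemma phase_slope_le0 (R : realType) (k l y : R) : 0 <= k -> phase_slope k l y <= 0.
Proof.
move=> k0; rewrite /phase_slope oppr_le0.
have c1 := cos_le1 y; have c2 := cos_geN1 y.
have c3 : cos y ^+ 2 <= 1 by nra.
have k2 := sqr_ge0 k; have l2 := sqr_ge0 l.
apply: divr_ge0.
  by apply: addr_ge0 (sqr_ge0 _); apply: mulr_ge0; nra.
by apply: mulr_ge0; [lra|apply: addr_ge0; [lra|apply: mulr_ge0; lra]].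
Qed.

(** First order expansion of the phase around the right end y of a segment. The slope at
    an intermediate point c differs from the slope at y by at most
    M |phase c - phase y| <= M^2 |c - y|, so no second derivative is needed; the
    constant depends on neither x nor y. *)
Lemma phase_increment (R : realType) (k l : R) : 0 <= k -> 0 < l ->
  exists2 M, 0 <= M & forall x y, 0 < x -> x <= y -> y < pi ->
    [/\ `|phase_slope k l (phase k l y)| <= M,
        0 <= phase k l x - phase k l y <= M * (y - x) &
        `|phase k l x - phase k l y - phase_slope k l (phase k l y) * (x - y)|
          <= M ^+ 2 * (y - x) ^+ 2].
Proof.
move=> k0 l0; have [M HM] := phase_slope_bounded_lipschitz k l0.
have M0 : 0 <= M by apply: le_trans (normr_ge0 _) (HM 0 0).1.
exists M => // x y x0 xy ypi.
have mv z : x <= z -> z <= y -> exists2 c, z <= c <= y &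
    phase k l y - phase k l z = phase_slope k l (phase k l c) * (y - z).
  move=> xz zy.
  apply: (@mean_value R (phase k l) (fun c => phase_slope k l (phase k l c)) z y zy).
  move=> t /andP[zt ty]; apply: phase_is_derive => //.
  by rewrite gt_eqF// sin_gt0_pi//; apply/andP; split; lra.
have incr z : x <= z -> z <= y -> 0 <= phase k l z - phase k l y <= M * (y - z).
  move=> xz zy; have [c _ e] := mv z xz zy.
  have := phase_slope_le0 l (phase k l c) k0; have := (HM (phase k l c) 0).1.
  by rewrite ler_norml => /andP[s1 _] s2; apply/andP; split; nra.
split; [exact: (HM _ 0).1|exact: incr|].
have [c /andP[xc cy] e] := mv x (lexx _) xy.
have -> : phase k l x - phase k l y - phase_slope k l (phase k l y) * (x - y) =
  - (phase_slope k l (phase k l c) - phase_slope k l (phase k l y)) * (y - x).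
  by rewrite -[phase k l x - _]opprB e; ring.
rewrite normrM normrN (ger0_norm (_ : 0 <= y - x)) ?subr_ge0//.
have dc : `|phase k l c - phase k l y| <= M * (y - x).
  have /andP[c1 c2] := incr c xc cy; rewrite ger0_norm//.
  by apply: le_trans c2 _; rewrite ler_wpM2l// lerD2l lerN2.
have -> : M ^+ 2 * (y - x) ^+ 2 = M * (M * (y - x)) * (y - x) by ring.
rewrite ler_wpM2r ?subr_ge0//; apply: le_trans (HM _ _).2 _.
by rewrite ler_wpM2l.
Qed.

(** The phase is nonincreasing and bounded, so it has a limit at pi, and the Lipschitz
    estimate passes to this limit. *)
Lemma phase_at_left_pi (R : realType) (k l M x : R) : 0 <= k -> 0 < l ->
  (forall x y, 0 < x -> x <= y -> y < pi ->
     0 <= phase k l x - phase k l y <= M * (y - x)) -> 0 <= M -> 0 < x < pi ->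
  let L := lim (phase k l y @[y --> pi^'-]) in
  - pi <= L /\ 0 <= phase k l x - L <= M * (pi - x).
Proof.
move=> k0 l0 incr M0 /andP[x0 xpi] L.
have near_x : \forall y \near pi^'-, x <= y < pi.
  near=> y; apply/andP; split; first by near: y; exact: nbhs_left_ge.
  by near: y; exact: nbhs_left_lt.
have cv : cvg (phase k l y @[y --> pi^'-]).
  have -> : phase k l = (fun y => - (- phase k l y)) by apply/funext => y; rewrite opprK.
  apply: is_cvgN; apply: nondecreasing_at_left_is_cvgr.
    near=> z => a b; rewrite !in_itv/= => /andP[za _] /andP[_ bpi] ab.
    have z0 : 0 < z by near: z; apply: nbhs_left_gt; exact: pi_gt0.
    by rewrite lerN2 -subr_ge0; have /andP[] := incr a b (lt_trans z0 za) ab bpi.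
  near=> z; exists pi => _ [y _ <-].
  by have := phase_gtNpi k l y; lra.
split.
  by apply: limr_ge => //; near=> y; rewrite ltW// phase_gtNpi.
apply/andP; split.
  rewrite subr_ge0; apply: limr_le => //; near=> y.
  have /andP[xy ypi] : x <= y < pi by near: y.
  by have /andP[] := incr x y x0 xy ypi; rewrite subr_ge0.
rewrite lerBlDr -lerBlDl; apply: limr_ge => //; near=> y.
have /andP[xy ypi] : x <= y < pi by near: y.
have /andP[_ h] := incr x y x0 xy ypi; have : M * (y - x) <= M * (pi - x).
  by rewrite ler_wpM2l// lerD2r ltW.
by lra.
Unshelve. all: by end_near.
Qed.

(** Here h stands for 1 / n, d + E h for the exact solution, e for eta (d) and e1 for
    eta' (d). The first order hypothesis carries the factor sin d in order to cover
    d = pi, where nothing is known about e1. *)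
Lemma eigenvalue_expansion_bound (R : realType) (d E e e1 K M h : R) :
  0 <= h -> 0 <= M -> `|E| <= pi -> `|e| <= pi -> `|E - e| <= M * pi * h ->
  `|sin d * (E - e - e * e1 * h)| <= K * h ^+ 2 ->
  `|g (d + E * h) - (g d + 2 * sin d * e * h +
     (2 * sin d * e * e1 + 1 / 2 * (2 * cos d) * e ^+ 2) * h ^+ 2)|
  <= (4 * pi ^+ 3 + 2 * K + 2 * M * pi ^+ 2) * h ^+ 3.
Proof.
move=> h0 M0 Epi epi Ee sinE.
have -> : g (d + E * h) - (g d + 2 * sin d * e * h +
     (2 * sin d * e * e1 + 1 / 2 * (2 * cos d) * e ^+ 2) * h ^+ 2) =
  (g (d + E * h) - (g d + 2 * sin d * (E * h) + cos d * (E * h) ^+ 2))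
  + 2 * (sin d * (E - e - e * e1 * h)) * h + cos d * (E - e) * (E + e) * h ^+ 2.
  by move: (g (d + _)) => ?; field.
have t1 : `|g (d + E * h) - (g d + 2 * sin d * (E * h) + cos d * (E * h) ^+ 2)|
    <= 4 * pi ^+ 3 * h ^+ 3.
  apply: le_trans (g_taylor2 _ _) _; rewrite -mulrA ler_pM2l// -exprMn.
  by rewrite lerXn2r ?nnegrE ?mulr_ge0 ?pi_ge0// normrM (ger0_norm h0) ler_wpM2r.
have t2 : `|2 * (sin d * (E - e - e * e1 * h)) * h| <= 2 * K * h ^+ 3.
  rewrite normrM (ger0_norm h0) normrM normr_nat.
  have -> : 2 * K * h ^+ 3 = 2 * (K * h ^+ 2) * h by ring.
  by rewrite ler_wpM2r// ler_pM2l.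
have t3 : `|cos d * (E - e) * (E + e) * h ^+ 2| <= 2 * M * pi ^+ 2 * h ^+ 3.
  rewrite normrM (ger0_norm (sqr_ge0 h)) !normrM.
  have -> : 2 * M * pi ^+ 2 * h ^+ 3 = (1 * (M * pi * h)) * (pi + pi) * h ^+ 2 by ring.
  rewrite ler_wpM2r ?sqr_ge0// ler_pM ?mulr_ge0// ?ler_pM ?cos_max//.
  by rewrite (le_trans (ler_normD _ _))// lerD.
apply: le_trans (ler_normD _ _) _; apply: le_trans (lerD (ler_normD _ _) (lexx _)) _.
by move: t1 t2 t3; lra.
Qed.

(** For j = n the hypotheses leave e1 arbitrary: its coefficient sin pi vanishes. *)
Lemma phase_expansion (R : realType) (k l : R) : 0 <= k -> 0 < l ->
  exists2 C, 0 < C & forall (n j : nat) (x e e1 : R), (1 <= j <= n)%N ->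
    let d := j%:R * pi / n%:R in
    0 < x -> x < d -> n%:R * x = j%:R * pi + phase k l x ->
    ((j < n)%N -> e = phase k l d /\ e1 = phase_slope k l (phase k l d)) ->
    (j = n -> e = lim (phase k l y @[y --> pi^'-])) ->
    `|g x - (g d + 2 * sin d * e / n%:R +
       (2 * sin d * e * e1 + 1 / 2 * (2 * cos d) * e ^+ 2) / n%:R ^+ 2)|
    <= C / n%:R ^+ 3.
Proof.
move=> k0 l0; have [M M0 incr] := phase_increment k0 l0.
have p0 := pi_gt0 R.
pose K := M ^+ 2 * pi ^+ 2 + M ^+ 2 * pi.
have K0 : 0 <= K by rewrite addr_ge0// mulr_ge0 ?sqr_ge0// ltW.
exists (4 * pi ^+ 3 + 2 * K + 2 * M * pi ^+ 2).
  by rewrite ltr_wpDr ?ltr_wpDr ?mulr_ge0 ?mulr_gt0 ?exprn_gt0// ltW ?exprn_gt0.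
move=> n j x e e1 /andP[j0 jn] d x0 xd nx ein epi.
have n0 : 0 < n%:R :> R by rewrite ltr0n; lia.
pose h := (n%:R)^-1 : R; have h0 : 0 < h by rewrite invr_gt0.
have xE : x = d + phase k l x * h.
  by rewrite /d /h -mulrDl -nx mulrC mulKf// gt_eqF.
have E1 := phase_lt0 k x l0; have E2 := phase_gtNpi k l x.
have dx : d - x <= pi * h by rewrite {1}xE; nra.
have [e_le [Ee sin_le]] : `|e| <= pi /\ (`|phase k l x - e| <= M * pi * h /\
    `|sin d * (phase k l x - e - e * e1 * h)| <= K * h ^+ 2).
  have [jn'|jn'] := eqVneq j n.
    have dpi : d = pi by rewrite /d jn' mulrC mulKf// gt_eqF.
    have xpi : 0 < x < pi by rewrite x0 -dpi.
    have [|L1 /andP[L2 L3]] := @phase_at_left_pi R k l M x k0 l0 _ M0 xpi.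
      by move=> a b a0 ab bpi; have [] := incr a b a0 ab bpi.
    rewrite -(epi jn') -dpi in L1 L2 L3.
    split; first by rewrite ler_norml; apply/andP; split; lra.
    split; first by rewrite ger0_norm// (le_trans L3)// -mulrA ler_wpM2l.
    by rewrite dpi sinpi mul0r normr0 mulr_ge0// sqr_ge0.
  have jltn : (j < n)%N by rewrite ltn_neqAle jn' jn.
  have [eE e1E] := ein jltn.
  have dpi : d < pi by rewrite ltr_pdivrMr// mulrC ltr_pM2l// ltr_nat.
  have [s1 /andP[s2 s3] s4] := incr x d x0 (ltW xd) dpi.
  have e_lt0 := phase_lt0 k d l0; have e_gt := phase_gtNpi k l d.
  rewrite -e1E in s1 s4; rewrite -eE in s1 s2 s3 s4 e_lt0 e_gt.
  have t1 : `|phase k l x - e| <= M * pi * h.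
    by rewrite ger0_norm// (le_trans s3)// -mulrA ler_wpM2l.
  split; first by rewrite ler_norml; apply/andP; split; lra.
  split=> //; rewrite normrM.
  have -> : phase k l x - e - e * e1 * h =
    (phase k l x - e - e1 * (x - d)) + e1 * (phase k l x - e) * h.
    by rewrite [in x - d]xE; ring.
  rewrite -[leRHS]mul1r ler_pM ?sin_max//.
  rewrite (le_trans (ler_normD _ _))// mulrDl lerD//.
    apply: le_trans s4 _; rewrite -mulrA ler_wpM2l ?sqr_ge0// -exprMn.
    by rewrite lerXn2r ?nnegrE ?subr_ge0 ?mulr_ge0// ltW.
  rewrite !normrM (ger0_norm (ltW h0)).
  have -> : M ^+ 2 * pi * h ^+ 2 = M * (M * pi * h) * h by ring.
  by rewrite ler_wpM2r ?(ltW h0)// ler_pM.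
rewrite -/h -!exprVn -/h {1}xE.
apply: eigenvalue_expansion_bound => //; first exact: ltW.
by rewrite ler_norml; apply/andP; split; lra.
Qed.

Lemma eta_interior (R : realType) (alpha : R[i]) (j : nat) (d : R) :
  alpha <> 1 -> alpha <> -1 -> 0 < d < pi ->
  eta alpha j d = phase (kcoef (twist j alpha)) (lcoef (twist j alpha)) d.
Proof.
by move=> a1 aN1 /andP[d0 dpi]; rewrite /eta gt_eqF// lt_eqF// eta_openE.
Qed.

Lemma eta_pi (R : realType) (alpha : R[i]) (j : nat) :
  alpha <> 1 -> alpha <> -1 ->
  eta alpha j pi =
    lim (phase (kcoef (twist j alpha)) (lcoef (twist j alpha)) y @[y --> pi^'-]).
Proof.
move=> a1 aN1; rewrite /eta gt_eqF ?pi_gt0// eqxx.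
by have -> : eta_open alpha j = phase (kcoef (twist j alpha)) (lcoef (twist j alpha))
  by apply/funext => y; exact: eta_openE.
Qed.

Lemma eta'_interior (R : realType) (alpha : R[i]) (j : nat) (d : R) :
  0 <= kcoef (twist j alpha) -> 0 < lcoef (twist j alpha) ->
  alpha <> 1 -> alpha <> -1 -> 0 < d < pi ->
  eta' alpha j d = phase_slope (kcoef (twist j alpha)) (lcoef (twist j alpha))
    (phase (kcoef (twist j alpha)) (lcoef (twist j alpha)) d).
Proof.
move=> k0 l0 a1 aN1 dpi; have /andP[d0 d1] := dpi.
rewrite /eta' gt_eqF// lt_eqF// derive1E; apply: derive_val.
apply: near_eq_is_derive (phase_is_derive k0 l0 _); last first.
  by rewrite gt_eqF// sin_gt0_pi.
near=> y; rewrite eta_interior//; apply/andP; split.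
  by near: y; exact: lt_nbhsr.
by near: y; exact: lt_nbhsl.
Unshelve. all: by end_near.
Qed.

Theorem theorem3 (R : realType) (alpha : R[i])
    (halpha : cabs alpha <= 1) (halpha1 : alpha <> 1) (halphaN1 : alpha <> -1) :
  exists2 C1 : R, 0 < C1 &
    exists N : nat, forall n : nat, (3 <= n)%N -> (N <= n)%N ->
      forall j : nat, (1 <= j <= n)%N ->
        `| lambda alpha n j - lambda_asympt alpha n j | <= C1 / n%:R ^+ 3.
Proof.
have k0 i : 0 <= kcoef (twist i alpha) by exact: kcoef_twist_ge0.
have l0 i : 0 < lcoef (twist i alpha) by exact: lcoef_twist_gt0.
(* Only the parity of j matters in the twist: two constants suffice. *)
have [C0 C00 exp0] := phase_expansion (k0 0%N) (l0 0%N).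
have [C1 C10 exp1] := phase_expansion (k0 1%N) (l0 1%N).
exists (C0 + C1); first exact: addr_gt0.
exists 0%N => n n3 _ j jn.
have [x [/andP[xl xd] nx ->]] := lambda_eq_g halpha halpha1 halphaN1 n3 jn.
have n0 : 0 < n%:R :> R by rewrite ltr0n; lia.
have x0 : 0 < x by apply: le_lt_trans xl; rewrite divr_ge0 ?mulr_ge0 ?pi_ge0// ltW.
rewrite /lambda_asympt g_derive1 g_derive2.
set d := j%:R * pi / n%:R; set e := eta alpha j d; set e1 := eta' alpha j d.
set k := kcoef (twist j alpha) in nx; set l := lcoef (twist j alpha) in nx.
have e_int : (j < n)%N -> e = phase k l d /\ e1 = phase_slope k l (phase k l d).
  move=> jltn; have d0pi : 0 < d < pi.
    rewrite (lt_trans x0 xd)/=.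
    by rewrite ltr_pdivrMr// mulrC ltr_pM2l ?pi_gt0// ltr_nat.
  by split; [exact: eta_interior|exact: eta'_interior].
have e_pi : j = n -> e = lim (phase k l y @[y --> pi^'-]).
  move=> jn'; have dpi : d = pi by rewrite /d jn' mulrC mulKf// gt_eqF.
  by rewrite /e dpi eta_pi.
have Cn (c c' : R) : 0 < c' -> c / n%:R ^+ 3 <= (c + c') / n%:R ^+ 3.
  by move=> c'0; rewrite ler_pM2r ?invr_gt0 ?exprn_gt0// lerDl ltW.
have [oj|oj] := boolP (odd j).
  have tw : twist j alpha = twist 1 alpha by rewrite !twist_odd oj.
  rewrite [C0 + C1]addrC; apply: le_trans (Cn C1 C0 C00).
  by apply: exp1 => //; rewrite -tw.
have tw : twist j alpha = twist 0 alpha by rewrite !twist_odd (negbTE oj).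
apply: le_trans (Cn C0 C1 C10).
by apply: exp0 => //; rewrite -tw.
Qed.
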